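(* Let $P,Q\subset\mathbb{R}^d$ be two simplices with vertices $p_1,\dots,p_n$ and $q_1,\dots,q_n$ respectively (vertex $p_i$ corresponding to $q_i$), such that (i) $0\in\operatorname{int}(Q)$, (ii) $\|q_i-q_j\|\le\|p_i-p_j\|$ for all $i,j$, and (iii) $\|q_i\|\ge\|p_i\|$ for all $i$. Then $P$ and $Q$ are isometric via an orthogonal transformation: there is an orthogonal linear map $O$ of $\mathbb{R}^d$ with $Op_i=q_i$ for all $i$. *)

(* Defs.v *)
From HB Require Import structures.
From mathcomp Require Import all_boot all_order all_algebra.
From mathcomp Require Import all_classical all_reals all_analysis.
Import Order.TTheory GRing.Theory Num.Theory.
Import numFieldNormedType.Exports.

Set Implicit Arguments.
Unset Strict Implicit.
Unset Printing Implicit Defensive.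

Local Open Scope classical_set_scope.
Local Open Scope ring_scope.

(* The norm `|x| that MathComp-Analysis puts on matrices is the sup norm; it
   induces the usual topology on R^d but not the Euclidean distance. *)
Definition enorm (R : realType) (d : nat) (x : 'cV[R]_d) : R :=
  Num.sqrt (\sum_(k < d) x k ord0 ^+ 2).

Definition affinely_independent (R : realType) (d n : nat)
    (v : 'I_n -> 'cV[R]_d) : Prop :=
  forall w : 'I_n -> R,
    \sum_(i < n) w i = 0 -> \sum_(i < n) w i *: v i = 0 ->
    forall i, w i = 0.

(* The convex hull of v; it is a simplex with vertices v_i when v is
   affinely independent. *)
Definition simplex (R : realType) (d n : nat)
    (v : 'I_n -> 'cV[R]_d) : set 'cV[R]_d :=
  [set x | exists w : 'I_n -> R,
     [/\ forall i, 0 <= w i, \sum_(i < n) w i = 1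
       & x = \sum_(i < n) w i *: v i]].

Definition affine_hull (R : realType) (d : nat)
    (A : set 'cV[R]_d) : set 'cV[R]_d :=
  [set x | exists m (a : 'I_m -> 'cV[R]_d) (w : 'I_m -> R),
     [/\ forall i, A (a i), \sum_(i < m) w i = 1
       & x = \sum_(i < m) w i *: a i]].

(* The interior of a simplex of any dimension is its interior relative to its
   affine hull. For a d-dimensional simplex of R^d, this is the topological
   interior: see [relint_full_simplex]. *)
Definition relint (R : realType) (d : nat)
    (A : set 'cV[R]_d) : set 'cV[R]_d :=
  [set x | A x /\ \forall y \near x, affine_hull A y -> A y].

Definition orthogonal_mx (R : realType) (d : nat) (O : 'M[R]_d) : Prop :=
  O^T *m O = 1%:M.

Lemma interior_relint (R : realType) (d : nat) (A : set 'cV[R]_d) :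
  interior A `<=` relint A.
Proof.
move=> x Ax; split; first exact: nbhs_singleton.
by apply: filterS Ax => y Ay _.
Qed.

Lemma simplex_vertex (R : realType) (d n : nat) (v : 'I_n -> 'cV[R]_d) i :
  simplex v (v i).
Proof.
exists (fun j => (j == i)%:R); split => [j||].
- exact: ler0n.
- by rewrite (bigD1 i) //= eqxx big1 ?addr0 // => j /negPf ->.
- rewrite (bigD1 i) //= eqxx scale1r big1 ?addr0 // => j /negPf ->.
  by rewrite scale0r.
Qed.

Lemma affine_hull_full_simplex (R : realType) (d : nat)
    (v : 'I_(d + 1) -> 'cV[R]_d) :
  affinely_independent v -> affine_hull (simplex v) = setT.
Proof.
move=> vfree; apply/seteqP; split=> // x _.
pose M : 'M[R]_(d + 1) := \matrix_i row_mx (v i)^T (const_mx 1 : 'rV[R]_1).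
have ME (w : 'rV_(d + 1)) :
    w *m M = row_mx (\sum_i w 0 i *: v i)^T (const_mx (\sum_i w 0 i)).
  rewrite mulmx_sum_row; apply/rowP => k; rewrite -(fintype.splitK k).
  case: (fintype.split k) => j; rewrite summxE ?row_mxEl ?row_mxEr.
    by rewrite mxE summxE; apply: eq_bigr => i _; rewrite mxE rowK row_mxEl !mxE.
  by rewrite mxE; apply: eq_bigr => i _; rewrite mxE rowK row_mxEr mxE mulr1.
have Mu : M \in unitmx.
  rewrite -row_free_unit -kermx_eq0; apply/rowV0P => w /sub_kermxP; rewrite ME.
  rewrite -[RHS]row_mx0 => /eq_row_mx[/(congr1 trmx)].
  rewrite trmxK trmx0 => w1 /rowP/(_ 0); rewrite !mxE => w2.
  by apply/rowP => i; rewrite mxE; exact: (vfree (fun i => w 0 i)).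
pose w := row_mx x^T (const_mx 1) *m invmx M.
have := ME w; rewrite mulmxKV // => /eq_row_mx[/trmx_inj xE /rowP/(_ 0)].
rewrite !mxE => w1; exists (d + 1)%N, v, (fun i => w 0 i); split => //.
exact: simplex_vertex.
Qed.

Lemma relint_full_simplex (R : realType) (d : nat)
    (v : 'I_(d + 1) -> 'cV[R]_d) :
  affinely_independent v -> relint (simplex v) = interior (simplex v).
Proof.
move=> vfree; apply/seteqP; split=> [x [_]|]; last exact: interior_relint.
by rewrite affine_hull_full_simplex //; apply: filterS => y; apply.
Qed.

(* Main.v *)
(* Since 0 is relatively interior to Q, it is a combination of the q_i with all
   weights w_i > 0. Let g_ij = <q_i,q_j> - <p_i,p_j>. The hypotheses give
   g_ii >= 0 and 2 g_ij >= g_ii + g_jj >= 0, whereas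
   \sum_ij w_i w_j g_ij = - |\sum_i w_i p_i|^2 <= 0; hence g = 0. Two families
   with the same Gram matrix are then matched one vector at a time by
   reflections. *)
Require Import Defs.
From HB Require Import structures.
From mathcomp Require Import all_boot all_order all_algebra.
From mathcomp Require Import all_classical all_reals all_analysis.
From mathcomp Require Import ring lra.
Import Order.TTheory GRing.Theory Num.Theory.
Import numFieldNormedType.Exports.

Set Implicit Arguments.
Unset Strict Implicit.
Unset Printing Implicit Defensive.

Local Open Scope classical_set_scope.
Local Open Scope ring_scope.

Definition dot (R : realType) (d : nat) (x y : 'cV[R]_d) : R :=
  \sum_(k < d) x k ord0 * y k ord0.

Section Dot.
Context {R : realType} {d : nat}.
Implicit Types x y z : 'cV[R]_d.

Lemma dotC x y : dot x y = dot y x.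
Proof. by apply: eq_bigr => k _; rewrite mulrC. Qed.

Lemma dotBl x y z : dot (x - y) z = dot x z - dot y z.
Proof. by rewrite /dot -sumrB; apply: eq_bigr => k _; rewrite !mxE mulrBl. Qed.

Lemma dotBr x y z : dot z (x - y) = dot z x - dot z y.
Proof. by rewrite dotC dotBl !(dotC z). Qed.

Lemma dot_ge0 x : 0 <= dot x x.
Proof. by apply: sumr_ge0 => k _; rewrite -expr2 sqr_ge0. Qed.

Lemma dot_eq0 x : (dot x x == 0) = (x == 0).
Proof.
apply/eqP/eqP => [/psumr_eq0P x0|->]; last first.
  by rewrite /dot big1 // => k _; rewrite mxE mul0r.
apply/colP => k; rewrite mxE; apply/eqP.
by rewrite -sqrf_eq0 expr2 x0 // => j _; rewrite -expr2 sqr_ge0.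
Qed.

Lemma dot_sum n (w : 'I_n -> R) (v : 'I_n -> 'cV[R]_d) :
  dot (\sum_i w i *: v i) (\sum_i w i *: v i) =
  \sum_i \sum_j w i * w j * dot (v i) (v j).
Proof.
rewrite /dot; under [RHS]eq_bigr do
  (under eq_bigr do rewrite mulr_sumr; rewrite exchange_big).
rewrite exchange_big; apply: eq_bigr => k _; rewrite !summxE big_distrlr /=.
by apply: eq_bigr => i _; apply: eq_bigr => j _; rewrite !mxE mulrACA.
Qed.

Lemma mulmx_dot x y : x^T *m y = (dot x y)%:M.
Proof.
apply/matrixP => i j; rewrite !ord1 !mxE mulr1n.
by apply: eq_bigr => k _; rewrite mxE.
Qed.

Lemma dot_orthogonal (O : 'M[R]_d) x y :
  orthogonal_mx O -> dot (O *m x) (O *m y) = dot x y.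
Proof.
move=> OO.
suff /matrixP/(_ 0 0) : (dot (O *m x) (O *m y))%:M = (dot x y)%:M :> 'M[R]_(1, 1).
  by rewrite !mxE !mulr1n.
by rewrite -!mulmx_dot trmx_mul -mulmxA (mulmxA O^T) OO mul1mx.
Qed.

(** Turns the hypotheses on [enorm] into inequalities that are linear in the values of [dot], which
    [lra] can then combine. *)
Lemma le_enorm x y : (enorm x <= enorm y) = (dot x x <= dot y y).
Proof.
have dotE z : \sum_k z k ord0 ^+ 2 = dot z z by apply: eq_bigr => k _; rewrite expr2.
by rewrite /enorm !dotE ler_sqrt // dot_ge0.
Qed.

End Dot.

Lemma orthogonal_mulmx (R : realType) (d : nat) (A B : 'M[R]_d) :
  orthogonal_mx A -> orthogonal_mx B -> orthogonal_mx (A *m B).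
Proof.
by move=> AA BB; rewrite /orthogonal_mx trmx_mul -mulmxA (mulmxA A^T) AA mul1mx.
Qed.

(** For distinct [x] and [y], [H] is the Householder reflection in the hyperplane orthogonal to
    [x - y]. The last clause says that this hyperplane is fixed pointwise. *)
Lemma reflection_exists (R : realType) (d : nat) (x y : 'cV[R]_d) :
  dot x x = dot y y ->
  exists H : 'M[R]_d, [/\ orthogonal_mx H, H *m x = y &
    forall z, dot x z = dot y z -> H *m z = z].
Proof.
move=> xy; have [<-|neq_xy] := eqVneq x y.
  exists 1%:M; split=> [||z _]; rewrite ?mul1mx //.
  by rewrite /orthogonal_mx trmx1 mul1mx.
pose v := x - y; pose c := dot v v; pose H : 'M[R]_d := 1%:M - (2 / c) *: (v *m v^T).
have c0 : c != 0 by rewrite dot_eq0 subr_eq0.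
have HE z : H *m z = z - (2 / c * dot v z) *: v.
  by rewrite mulmxBl mul1mx -scalemxAl -mulmxA mulmx_dot mul_mx_scalar scalerA.
exists H; split.
(* Since [H] is symmetric, orthogonality means [H *m H = 1]; expanding the second factor reduces
   this to [H *m v = - v]. *)
- have HT : H^T = H by rewrite linearB /= trmx1 linearZ /= trmx_mul trmxK.
  have Hv : H *m v = - v.
    by rewrite HE -/c divfK // scaler_nat mulr2n opprD addrA subrr add0r.
  rewrite /orthogonal_mx HT {2}/H mulmxBr mulmx1 -scalemxAr mulmxA Hv mulNmx.
  by rewrite scalerN opprK /H subrK.
(* Equality of the two norms enters here: it makes the coefficient [2 / c * dot v x] equal to 1, so
   [H] sends [x] to [x - v = y]. *)
- have cE : c = 2 * dot v x.
    by rewrite /c /v !dotBl !dotBr (dotC x y) xy; ring.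
  have v0 : dot v x != 0 by apply: contraNneq c0 => v0; rewrite cE v0 mulr0.
  have -> : y = x - v by rewrite /v opprB addrCA subrr addr0.
  by rewrite HE mulrAC -cE divff // scale1r.
- by move=> z xz; rewrite HE dotBl xz subrr mulr0 scale0r subr0.
Qed.

Lemma eq_gram_orthogonal (R : realType) (d n : nat) (p q : 'I_n -> 'cV[R]_d) :
  (forall i j, dot (p i) (p j) = dot (q i) (q j)) ->
  exists O : 'M[R]_d, orthogonal_mx O /\ forall i, O *m p i = q i.
Proof.
move=> gram; suff /(_ n) [U [UU Up]] : forall m : nat, exists O : 'M[R]_d,
    orthogonal_mx O /\ forall i : 'I_n, (i < m)%N -> O *m p i = q i.
  by exists U; split=> // i; apply: Up.
elim=> [|m [U [UU Up]]].
  by exists 1%:M; split=> //; rewrite /orthogonal_mx trmx1 mul1mx.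
(* Once [m] reaches [n], every index is already matched and [U] is kept. *)
have [lt_mn|le_nm] := ltnP m n; last first.
  by exists U; split=> // i _; apply: Up; apply: leq_trans le_nm.
pose k := Ordinal lt_mn.
have [|H [HH Hk Hfix]] := @reflection_exists R d (U *m p k) (q k).
  by rewrite dot_orthogonal.
exists (H *m U); split; first exact: orthogonal_mulmx.
move=> i; rewrite ltnS leq_eqVlt => /predU1P[im|im]; rewrite -mulmxA.
  by have -> : i = k by exact: val_inj.
(* The reflection keeps earlier matches: for [i < m], the Gram hypothesis gives [q i = U *m p i] the
   same product with [U *m p k] as with [q k]. *)
by rewrite Up // Hfix // -{1}(Up _ im) dot_orthogonal.
Qed.

(* Moving slightly from 0 away from [v i] stays in the simplex, which gives a
   vanishing combination with a positive weight at [i]; sum these over [i]. *)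
Lemma relint_pos_weights (R : realType) (d n : nat) (v : 'I_n -> 'cV[R]_d) :
  relint (simplex v) 0 ->
  exists w : 'I_n -> R, (forall i, 0 < w i) /\ \sum_i w i *: v i = 0.
Proof.
move=> [v0 near0].
have /choice[u uP] : forall i, exists u : 'I_n -> R,
    [/\ forall j, 0 <= u j, 0 < u i & \sum_j u j *: v j = 0].
  move=> i.
  have cvg0 : (fun t : R => t *: - v i) @ 0^'+ --> (0 : 'cV[R]_d).
    rewrite -[X in _ --> X](scale0r (- v i)); apply: cvg_at_right_filter.
    exact: scalel_continuous.
  have [t [t0]] : exists t : R, 0 < t /\
      (affine_hull (simplex v) (t *: - v i) -> simplex v (t *: - v i)).
    apply: (@filter_ex _ (0^'+ : set_system R)).
    by apply: filterI; [exact: nbhs_right_gt | exact: cvg0 near0].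
  case=> [|u [u0 _ uE]].
    (* The point is the affine combination [(1 + t) *: 0 + (- t) *: v i] of two points of the
       simplex. *)
    exists 2%N, (fun j => if j == ord0 then 0 else v i),
      (fun j => if j == ord0 then 1 + t else - t); split=> [j||].
    - by case: ifP => // _; exact: simplex_vertex.
    - by rewrite !big_ord_recl big_ord0 /= addr0 addrK.
    - by rewrite !big_ord_recl big_ord0 /= addr0 scaler0 add0r scaleNr scalerN.
  (* Moving [t *: - v i] to the other side of [uE] adds [t] to the weight at [i]. *)
  exists (fun j => u j + (if j == i then t else 0)); split=> [j||].
  - by case: ifP => _; rewrite ?addr0 // addr_ge0 // ltW.
  - by rewrite eqxx ltr_wpDl.
  - under eq_bigr do rewrite scalerDl.
    rewrite big_split /= -uE (bigD1 i) //= eqxx big1 => [|j /negPf ->].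
      by rewrite addr0 scalerN addNr.
    by rewrite scale0r.
exists (fun j => \sum_i u i j); split=> [j|].
  rewrite (bigD1 j) //= ltr_pwDl //; first by have [] := uP j.
  by apply: sumr_ge0 => i _; have [] := uP i.
under eq_bigr do rewrite scaler_suml.
by rewrite exchange_big big1 // => i _; have [] := uP i.
Qed.

Theorem theorem2p1 (R : realType) (d n : nat) (p q : 'I_n -> 'cV[R]_d)
    (simplexP : affinely_independent p)
    (simplexQ : affinely_independent q)
    (zero_int : relint (simplex q) 0)
    (edges : forall i j : 'I_n, enorm (q i - q j) <= enorm (p i - p j))
    (radii : forall i : 'I_n, enorm (p i) <= enorm (q i)) :
  exists O : 'M[R]_d, orthogonal_mx O /\ forall i : 'I_n, O *m p i = q i.
Proof.
have [w [w0 wq]] := relint_pos_weights zero_int.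
pose g i j := dot (q i) (q j) - dot (p i) (p j).
have g_ge0 i j : 0 <= g i j.
  have := edges i j; have := radii i; have := radii j.
  rewrite !le_enorm !dotBl !dotBr (dotC (q j) (q i)) (dotC (p j) (p i)) /g; lra.
have wg_ge0 i j : 0 <= w i * w j * g i j by rewrite !mulr_ge0 // ltW.
have sum_ge0 i : 0 <= \sum_j w i * w j * g i j by apply: sumr_ge0.
have sum_g : \sum_i \sum_j w i * w j * g i j = 0.
  apply/eqP; rewrite eq_le sumr_ge0 // andbT.
  under eq_bigr do (under eq_bigr do rewrite mulrBr; rewrite sumrB).
  rewrite sumrB -!dot_sum wq subr_le0.
  by rewrite (eqP (_ : dot 0 0 == 0)) ?dot_ge0 // dot_eq0.
apply: eq_gram_orthogonal => i j; apply/esym/eqP; rewrite -subr_eq0 -/(g i j).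
(* A vanishing sum of nonnegative terms has only zero terms; this is applied to the rows, then
   within row [i], and the positive weights cancel. *)
have sum_gi : \sum_j w i * w j * g i j = 0.
  by apply: (psumr_eq0P _ sum_g) => // k _; exact: sum_ge0.
have : w i * w j * g i j = 0 by apply: (psumr_eq0P _ sum_gi).
by move=> /eqP; rewrite !mulf_eq0 (gt_eqF (w0 i)) (gt_eqF (w0 j)).
Qed.
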